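(* Let $(\xi_n)_{n\ge1}$ be a sequence of independent random variables taking the values $0$ and $1$ with probabilities $p_{0n}\ge 0$ and $p_{1n}\ge 0$, respectively ($p_{0n}+p_{1n}=1$), and let $\xi=\Delta^{G_2}_{\xi_1\xi_2\ldots\xi_n\ldots}$. Then $\xi$ has either a pure discrete or a pure continuous distribution. Moreover, the distribution is discrete if and only if $$M\equiv\prod_{n=1}^\infty\max\{p_{0n},p_{1n}\}>0.$$ In the discrete case, the point spectrum (set of atoms) of $\xi$ is the tail set whose representative is a point $x_0=\Delta^{G_2}_{c_1c_2\ldots c_m\ldots}$ such that $p_{c_nn}=\max\{p_{0n},p_{1n}\}$ for all $n$, or a subset of this tail set.
   Context: Fix a real number $g_0\in[\frac12,1)$ and put $g_1=g_0-1$, $\delta_0=0$, $\delta_1=g_0$. For a sequence $(\alpha_n)_{n\ge1}$ of elements of $\{0,1\}$ put $$\Delta^{G_2}_{\alpha_1\alpha_2\ldots\alpha_n\ldots}=\delta_{\alpha_1}+\sum_{k=2}^\infty \delta_{\alpha_k}\prod_{j=1}^{k-1}g_{\alpha_j}\in[0,g_0].$$ Every $x\in[0,g_0]$ equals $\Delta^{G_2}_{\alpha_1\alpha_2\ldots}$ for some sequence of zeros and ones (a $G_2$-representation of $x$). The representation is unique except for countably many numbers having exactly two representations $\Delta^{G_2}_{\alpha_1\ldots\alpha_{m-1}01(0)}=\Delta^{G_2}_{\alpha_1\ldots\alpha_{m-1}11(0)}$, where $(0)$ denotes the period $000\ldots$. The representations $\Delta^{G_2}_{\alpha_1\alpha_2\ldots}$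 and $\Delta^{G_2}_{\beta_1\beta_2\ldots}$ have the same tail if there exist positive integers $k,m$ such that $\alpha_{k+j}=\beta_{m+j}$ for all $j\in\mathbb{N}$. A tail set is an equivalence class of this relation, regarded as a set of numbers in $[0,g_0]$ (the two representations of a number with two representations have the same tail); the tail set with representative $x_0$ is the class containing $x_0$. A distribution is pure discrete if it is concentrated on an at most countable set, and pure continuous if it has no atoms. *)

(* Defs.v *)
From HB Require Import structures.
From mathcomp Require Import all_boot all_order all_algebra.
From mathcomp Require Import all_classical all_reals all_analysis measurable_realfun.
Set Implicit Arguments.
Unset Strict Implicit.
Unset Printing Implicit Defensive.
Import Order.TTheory GRing.Theory Num.Theory.
Import numFieldNormedType.Exports.
Local Open Scope classical_set_scope.
Local Open Scope ring_scope.

(* Digits 0 and 1 are false and true.  All sequences are indexed from 0: the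
   n-th value here is the one traditionally indexed by n + 1. *)

Section representation.
Context {R : realType}.
Implicit Types (a b : nat -> bool).

Definition G2_g (g0 : R) (e : bool) : R := if e then g0 - 1 else g0.

Definition G2_delta (g0 : R) (e : bool) : R := if e then g0 else 0.

Definition G2_term (g0 : R) a : R^nat :=
  fun k => G2_delta g0 (a k) * \prod_(j < k) G2_g g0 (a j).

Definition G2 (g0 : R) a : R := limn (series (G2_term g0 a)).

(* With indices from 0, [a (k + j)] is the digit of 1-based index
   [k + (j + 1)], so [j] ranges over the positive integers [j + 1]. *)
Definition same_tail a b : Prop :=
  exists k m, [/\ (0 < k)%N, (0 < m)%N & forall j, a (k + j)%N = b (m + j)%N].

Definition G2_tail_set (g0 : R) (x0 : R) : set R :=
  [set x | exists a b, [/\ G2 g0 a = x0, G2 g0 b = x & same_tail a b]].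

Lemma is_cvg_G2 (g0 : R) a : 2^-1 <= g0 < 1 -> cvgn (series (G2_term g0 a)).
Proof.
move=> /andP[g0h g01]; have g0_ge0 : 0 <= g0 by apply: le_trans g0h.
have gle e : `|G2_g g0 e| <= g0.
  case: e => /=; last by rewrite ger0_norm.
  rewrite distrC ger0_norm; last by rewrite subr_ge0 ltW.
  rewrite lerBlDr -mulr2n -mulr_natr -ler_pdivrMr// mul1r; exact: g0h.
apply: normed_cvg; apply: (@series_le_cvg R _ (geometric 1 g0)).
- by move=> n; exact: normr_ge0.
- by move=> n /=; rewrite mul1r exprn_ge0.
- move=> n /=; rewrite /G2_term normrM; apply: ler_pM => //.
    by case: (a n); rewrite /= ?normr0 ?ler01// ger0_norm// ltW.
  rewrite normr_prod -[leRHS]mulr1; elim: n => [|n IH].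
    by rewrite big_ord0 expr0 mulr1.
  rewrite big_ord_recr/= exprSr mulr1; apply: ler_pM => //.
  - by rewrite prodr_ge0.
  - by rewrite -[leRHS]mulr1.
- by apply: is_cvg_geometric_series; rewrite ger0_norm.
Qed.

End representation.

Section random_representation.
Context d (T : measurableType d) (R : realType) (P : probability T R).

Lemma measurable_G2 (g0 : R) (hg0 : 2^-1 <= g0 < 1)
    (xi : nat -> {RV P >-> bool}) :
  measurable_fun setT (fun w => G2 g0 (fun n => xi n w)).
Proof.
have mcomp (h : bool -> R) n : measurable_fun setT (fun w => h (xi n w)).
  exact: (measurableT_comp (f := h)).
apply: (@measurable_fun_cvg _ _ _ _
  (fun m w => series (G2_term g0 (fun n => xi n w)) m)); last first.
  by move=> w _; exact: is_cvg_G2.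
move=> m; rewrite /series/=; apply: measurable_sum => k.
apply: measurable_funM; first exact: (mcomp (G2_delta g0)).
by apply: measurable_prod => j _; exact: (mcomp (G2_g g0)).
Qed.

Definition G2_RV (g0 : R) (hg0 : 2^-1 <= g0 < 1)
    (xi : nat -> {RV P >-> bool}) : {RV P >-> R} :=
  mfun_Sub (mem_set (measurable_G2 hg0 xi)).

Lemma G2_RVE (g0 : R) (hg0 : 2^-1 <= g0 < 1) (xi : nat -> {RV P >-> bool}) w :
  G2_RV hg0 xi w = G2 g0 (fun n => xi n w).
Proof. by []. Qed.

(* Mutual independence: the product rule over every finite subfamily. *)
Definition independent_RVs d' (T' : measurableType d') (I : eqType)
    (X : I -> {RV P >-> T'}) : Prop :=
  forall (s : seq I) (A : I -> set T'), uniq s ->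
    (forall i, measurable (A i)) ->
    P (\bigcap_(i in [set` s]) (X i @^-1` A i)) =
    (\prod_(i <- s) P (X i @^-1` A i))%E.

End random_representation.

Section distribution_types.
Context {R : realType}.
Implicit Type mu : probability R R.

Definition pure_discrete mu : Prop :=
  exists2 C : set R, countable C & mu (~` C) = 0%E.

Definition pure_continuous mu : Prop := forall x, mu [set x] = 0%E.

Definition point_spectrum mu : set R := [set x | (0 < mu [set x])%E].

End distribution_types.

Definition max_prob_product (R : realType) (p : bool -> nat -> R) : R :=
  limn (fun n => \prod_(k < n) Num.max (p false k) (p true k)).

(* Main.v *)
Require Import Defs.
From mathcomp Require Import all_boot all_order all_algebra.
From mathcomp Require Import all_classical all_reals all_analysis.
From mathcomp Require Import lra.
Set Implicit Arguments.
Unset Strict Implicit.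
Unset Printing Implicit Defensive.
Import Order.TTheory GRing.Theory Num.Theory.
Import numFieldNormedType.Exports.
Local Open Scope classical_set_scope.
Local Open Scope ring_scope.

(** Write [T_0 x = g0 * x] and [T_1 x = g0 + (g0 - 1) * x].  These maps send
    [[0, g0]] into itself, and [T_(a 0)] sends the
    value of the digits after the first to [G2 a] (G2_recl).

    Representations are almost unique.  The ranges of [T_0] and [T_1] meet only
    in [T_0 g0 = T_1 g0], and [g0] is represented only by [1(0)].  Hence two
    different digit sequences with the same value both end in zeros
    (G2_eq_terminates), so every fibre of [G2] is countable.

    Let [M_n] be the product of [max (p false k) (p true k)] over [k < n]; it is
    nonincreasing, with limit [M].

    If [M = 0], then by independence a given digit sequence has probability at
    most [M_n] for every [n], that is 0 (probability_sequence_eq0).  As fibres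
    are countable, no point is an atom, and a probability without atoms is not
    discrete.

    If [M > 0], let [c] select a most likely digit at each place.  The event
    that the digits agree with [c] from the place [N] on has probability at
    least [M / M_N], which tends to 1, so almost surely the digits eventually
    agree with [c] (probability_agree_eventually).  There are countably many
    such sequences, so the distribution is concentrated on the countable set of
    their values.  Atoms lie in any countable set of full measure
    (point_spectrum_subset), and the elements of this one share the tail of
    [c]. *)

(** * The representation map *)

(** The one-sided shift: the sequence without its first digit. *)
Definition behead_seq (a : nat -> bool) : nat -> bool := fun n => a n.+1.

Section representation.
Context {R : realType} (g0 : R) (hg0 : 2^-1 <= g0 < 1).
Implicit Types (a b c : nat -> bool) (e : bool).

Let g0_ge0 : 0 <= g0.
Proof. by case/andP: hg0 => h _; lra. Qed.

Lemma G2_branch_bound e (x : R) : 0 <= x <= g0 ->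
  0 <= G2_delta g0 e + G2_g g0 e * x <= g0.
Proof.
by case/andP: hg0 => h1 h2 /andP[x0 xg]; case: e => /=;
  apply/andP; split; nra.
Qed.

Lemma series_G2_term_recl a n :
  series (G2_term g0 a) n.+1 =
  G2_delta g0 (a 0) + G2_g g0 (a 0) * series (G2_term g0 (behead_seq a)) n.
Proof.
rewrite /series/= big_nat_recl//; congr (_ + _).
  by rewrite /G2_term big_ord0 mulr1.
rewrite mulr_sumr; apply: eq_bigr => i _.
by rewrite /G2_term big_ord_recl mulrCA.
Qed.

Lemma G2_recl a :
  G2 g0 a = G2_delta g0 (a 0) + G2_g g0 (a 0) * G2 g0 (behead_seq a).
Proof.
apply: cvg_lim => //; rewrite -cvg_shiftS.
rewrite (_ : [sequence _]_n = fun n => G2_delta g0 (a 0) +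
  G2_g g0 (a 0) * series (G2_term g0 (behead_seq a)) n); last first.
  by apply/funext => n; exact: series_G2_term_recl.
by apply: cvgD; [exact: cvg_cst | apply: cvgMr; exact: is_cvg_G2].
Qed.

Lemma series_G2_term_bound a n : 0 <= series (G2_term g0 a) n <= g0.
Proof.
elim: n a => [|n IH] a.
  by rewrite /series/= big_geq// lexx.
by rewrite series_G2_term_recl; exact: G2_branch_bound.
Qed.

Lemma G2_bound a : 0 <= G2 g0 a <= g0.
Proof.
apply/andP; split.
  apply: limr_ge; first exact: is_cvg_G2.
  by near=> n; case/andP: (series_G2_term_bound a n).
apply: limr_le; first exact: is_cvg_G2.
by near=> n; case/andP: (series_G2_term_bound a n).
Unshelve. all: by end_near. Qed.

(** No digit can be 1, because [g0 + (g0 - 1) * x] is at least [g0 ^+ 2 > 0] for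
    [x <= g0]. *)
Lemma G2_eq0 a : G2 g0 a = 0 -> forall n, a n = false.
Proof.
move=> a0 n; elim: n a a0 => [|n IH] a a0;
  have /andP[] := G2_bound (behead_seq a); move: a0; rewrite G2_recl;
  case: (a 0%N) => //= h h0 h1; case/andP: (hg0) => h2 h3; try nra.
by apply: (IH (behead_seq a)); nra.
Qed.

Lemma G2_eq_g0 a : G2 g0 a = g0 -> forall n, a n.+1 = false.
Proof.
rewrite G2_recl => h n; apply: (@G2_eq0 (behead_seq a)).
have /andP[] := G2_bound (behead_seq a); case/andP: (hg0) => h2 h3.
by case: (a 0%N) h => /= h h0 h1; nra.
Qed.

(** The images of [[0, g0]] under the two branches [x |-> g0 * x] and
    [x |-> g0 + (g0 - 1) * x] meet only in [g0 ^+ 2], which both branches take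
    at [g0]. *)
Lemma G2_eq_head a b : G2 g0 a = G2 g0 b ->
  if a 0%N == b 0%N then G2 g0 (behead_seq a) = G2 g0 (behead_seq b)
  else G2 g0 (behead_seq a) = g0 /\ G2 g0 (behead_seq b) = g0.
Proof.
rewrite (G2_recl a) (G2_recl b).
have /andP[] := G2_bound (behead_seq a); have /andP[] := G2_bound (behead_seq b).
move: (G2 g0 (behead_seq a)) (G2 g0 (behead_seq b)) => x y y0 yg x0 xg.
case/andP: (hg0) => h2 h3.
by case: (a 0%N); case: (b 0%N) => /= h; try (split; nra); nra.
Qed.

(** If two representations of the same number first differ at the place [m],
    then both consist of zeros from the place [m + 2] on; any place [n] where
    they differ satisfies [m <= n].  By symmetry it is enough to speak of [b]. *)
Lemma G2_eq_terminates a b n : G2 g0 a = G2 g0 b -> a n != b n ->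
  forall k, b (n.+2 + k)%N = false.
Proof.
elim: n a b => [|n IH] a b /G2_eq_head.
  by move=> /[swap] /negbTE-> [_ /G2_eq_g0 h] k; exact: (h k).
case: eqP => _; first by move=> h nab k; exact: (IH _ _ h nab).
by move=> [_ /G2_eq_g0 h] _ k; exact: (h (n.+1 + k)%N).
Qed.

End representation.

(** * Countable sets of sequences and countable unions *)

(** The sequence [c] with its first [size s] values replaced by those of [s]. *)
Definition overwrite c (s : seq bool) : nat -> bool := fun n => nth (c n) s n.

(** The sequences that agree with [c] from some place on, given as a range so
    that countability follows from that of [seq bool]. *)
Definition eventually_eq c : set (nat -> bool) := range (overwrite c).

Lemma countable_eventually_eq c : countable (eventually_eq c).
Proof. exact: (sub_countable (card_image_le _ _) (countableP _)). Qed.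

Lemma eventually_eqP c a :
  eventually_eq c a <-> exists N, forall n, (N <= n)%N -> a n = c n.
Proof.
split=> [[s _ <-]|[N aN]].
  by exists (size s) => n Nn; rewrite /overwrite nth_default.
exists (mkseq a N) => //; apply/funext => n; rewrite /overwrite.
have [nN|Nn] := ltnP n N; first by rewrite nth_mkseq.
by rewrite nth_default ?size_mkseq// aN.
Qed.

Lemma negligible_bigcup_countable d (T : measurableType d) (R : realType)
    (P : {measure set T -> \bar R}) (I : Type) (D : set I) (B : I -> set T) :
  countable D -> (forall i, D i -> P.-negligible (B i)) ->
  P.-negligible (\bigcup_(i in D) B i).
Proof.
move=> /countable_injP[f finj] B0.
(* Split [D] along the fibres of an injection into [nat]; each fibre has at
   most one element. *)
apply: (@negligibleS _ _ _ _
  (\bigcup_n \bigcup_(i in D `&` f @^-1` [set n]) B i)).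
  by move=> w [i Di Biw]; exists (f i) => //; exists i.
apply: negligible_bigcup => n.
have [[i [Di fin]]|nD] := pselect (exists i, (D `&` f @^-1` [set n]) i); last first.
  rewrite (_ : \bigcup_(i in _) _ = set0); first exact: negligible_set0.
  by apply/seteqP; split => // w [i Di _]; apply: nD; exists i.
apply: (negligibleS _ (B0 i Di)) => w [j [Dj fjn]] Bj.
suff -> : i = j by [].
by apply: finj; rewrite ?inE// fin fjn.
Qed.

(** * Random digits *)

Section digits.
Context d (T : measurableType d) (R : realType) (P : probability T R).
Variables (xi : nat -> {RV P >-> bool}) (p : bool -> nat -> R).
Hypothesis p_ge0 : forall e n, 0 <= p e n.
Hypothesis p_sum1 : forall n, p false n + p true n = 1.
Hypothesis xi_prob :
  forall (e : bool) (n : nat), P [set w | xi n w = e] = (p e n)%:E.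
Hypothesis xi_indep : independent_RVs xi.
Implicit Types (a c : nat -> bool) (N k n : nat).

(** The event that the digits agree with [a] at the [k] places starting with
    [N]. *)
Definition cylinder a N k : set T :=
  \bigcap_(n in [set` index_iota N (N + k)]) (xi n @^-1` [set a n]).

(** The event that the digits agree with [a] at all places from [N] on; for
    [N = 0] it is the event that [a] is the sequence of digits. *)
Definition agree_from a N : set T :=
  [set w | forall n, (N <= n)%N -> xi n w = a n].

Lemma probability_cylinder a N k :
  P (cylinder a N k) = (\prod_(N <= n < N + k) p (a n) n)%:E.
Proof.
rewrite xi_indep//; last exact: iota_uniq.
by rewrite -prodEFin; apply: eq_bigr => n _; exact: xi_prob.
Qed.

Lemma measurable_cylinder a N k : measurable (cylinder a N k).
Proof.
apply: bigcap_measurableType => //= n _.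
by rewrite -[X in measurable X]setTI; exact: measurable_funP.
Qed.

Lemma agree_from_bigcap a N : agree_from a N = \bigcap_k cylinder a N k.
Proof.
apply/seteqP; split=> w aw.
  by move=> k _ n /=; rewrite mem_index_iota => /andP[/aw].
move=> n Nn; apply: (aw (n - N).+1 I n) => /=.
by rewrite mem_index_iota Nn addnS subnKC//=.
Qed.

Lemma measurable_agree_from a N : measurable (agree_from a N).
Proof.
by rewrite agree_from_bigcap; apply: bigcapT_measurable => k;
  exact: measurable_cylinder.
Qed.

Lemma probability_agree_from_le a N k :
  (P (agree_from a N) <= (\prod_(N <= n < N + k) p (a n) n)%:E)%E.
Proof.
rewrite -probability_cylinder; apply: le_measure; rewrite ?inE.
- exact: measurable_agree_from.
- exact: measurable_cylinder.
- by rewrite agree_from_bigcap => w; apply.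
Qed.

Lemma probability_agree_from_ge a N (m : R) :
  (forall k, m <= \prod_(N <= n < N + k) p (a n) n) ->
  (m%:E <= P (agree_from a N))%E.
Proof.
move=> mp.
have cv : (P \o cylinder a N) k @[k --> \oo] --> P (agree_from a N).
  rewrite agree_from_bigcap; apply: nonincreasing_cvg_mu.
  - by rewrite (le_lt_trans (probability_le1 _ _)) ?ltry//;
      exact: measurable_cylinder.
  - by move=> k; exact: measurable_cylinder.
  - by rewrite -agree_from_bigcap; exact: measurable_agree_from.
  - move=> k l kl; apply/subsetPset => w aw n /=.
    rewrite mem_index_iota => /andP[Nn nk]; apply: aw => /=.
    by rewrite mem_index_iota Nn (leq_trans nk)// leq_add2l.
rewrite -(cvg_lim _ cv)//; apply: lime_ge.
  by apply/cvg_ex; eexists; exact: cv.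
by apply: nearW => k /=; rewrite probability_cylinder lee_fin.
Qed.

(** The partial products whose limit is [max_prob_product p]. *)
Definition max_partial n : R := \prod_(k < n) Num.max (p false k) (p true k).

Lemma max_prob_gt0 n : 0 < Num.max (p false n) (p true n).
Proof.
rewrite lt_max; have := p_sum1 n; have := p_ge0 false n; have := p_ge0 true n.
move=> h1 h0 h; have [//|h2] := ltP 0 (p false n).
rewrite /=; lra.
Qed.

Lemma le_max_prob e n : p e n <= Num.max (p false n) (p true n).
Proof. by case: e; rewrite le_max !lexx ?orbT. Qed.

Lemma max_prob_le1 n : Num.max (p false n) (p true n) <= 1.
Proof.
have := p_sum1 n; have := p_ge0 false n; have := p_ge0 true n; move=> h1 h0 h.
by rewrite ge_max; apply/andP; split; lra.
Qed.

Lemma max_partial_gt0 n : 0 < max_partial n.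
Proof. by apply: prodr_gt0 => i _; exact: max_prob_gt0. Qed.

Lemma max_partial_nonincreasing :
  {homo max_partial : n m / (n <= m)%N >-> m <= n}.
Proof.
apply/nonincreasing_seqP => n; rewrite /max_partial big_ord_recr/=.
by rewrite ler_piMr ?max_prob_le1// ltW ?max_partial_gt0.
Qed.

Lemma is_cvg_max_partial : cvgn max_partial.
Proof.
apply: nonincreasing_is_cvgn; first exact: max_partial_nonincreasing.
by exists 0 => _ [n _ <-]; rewrite ltW ?max_partial_gt0.
Qed.

Lemma max_prob_product_le n : max_prob_product p <= max_partial n.
Proof.
exact: (nonincreasing_cvgn_ge max_partial_nonincreasing is_cvg_max_partial).
Qed.

Lemma max_prob_product_ge0 : 0 <= max_prob_product p.
Proof.
apply: limr_ge; first exact: is_cvg_max_partial.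
by apply: nearW => n; rewrite ltW ?max_partial_gt0.
Qed.

Lemma probability_sequence_eq0 a :
  max_prob_product p = 0 -> P (agree_from a 0) = 0%E.
Proof.
move=> M0; apply/eqP; rewrite eq_le measure_ge0 andbT.
rewrite -(fineK (fin_num_measure P _ (measurable_agree_from a 0))) lee_fin -M0.
apply: limr_ge; first exact: is_cvg_max_partial.
apply: nearW => n; rewrite -lee_fin fineK; last first.
  by apply: fin_num_measure; exact: measurable_agree_from.
apply: (le_trans (probability_agree_from_le a 0 n)).
rewrite lee_fin add0n big_mkord; apply: ler_prod => i _.
by rewrite p_ge0 le_max_prob.
Qed.

Lemma probability_agree_eventually c :
    (forall n, p (c n) n = Num.max (p false n) (p true n)) ->
    0 < max_prob_product p ->
  P (\bigcup_N agree_from c N) = 1%E.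
Proof.
move=> cmax M_gt0.
have mU : measurable (\bigcup_N agree_from c N).
  by apply: bigcupT_measurable => N; exact: measurable_agree_from.
apply/eqP; rewrite eq_le probability_le1//=.
(* The product over [N <= n < N + k] is [max_partial (N + k) / max_partial N],
   which is bounded below uniformly in [k]. *)
have lb N : ((max_prob_product p / max_partial N)%:E <=
    P (\bigcup_N agree_from c N))%E.
  apply: (@le_trans _ _ (P (agree_from c N))).
    apply: probability_agree_from_ge => k.
    rewrite ler_pdivrMr ?max_partial_gt0//.
    apply: (le_trans (max_prob_product_le (N + k))).
    rewrite /max_partial -!(big_mkord xpredT
      (fun k => Num.max (p false k) (p true k))).
    rewrite (@big_cat_nat _ _ _ N)//= ?leq_addr// mulrC.
    by under [X in _ <= X * _]eq_bigr do rewrite cmax.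
  apply: le_measure; rewrite ?inE//; first exact: measurable_agree_from.
  exact: bigcup_sup.
have cv : max_prob_product p / max_partial N @[N --> \oo] --> (1 : R).
  rewrite -(divff (lt0r_neq0 M_gt0)); apply: cvgM; first exact: cvg_cst.
  by apply: cvgV; [rewrite gt_eqF|exact: is_cvg_max_partial].
rewrite -(fineK (fin_num_measure P _ mU)) lee_fin -(cvg_lim _ cv)//.
apply: limr_le; first by apply/cvg_ex; eexists; exact: cv.
by apply: nearW => N; rewrite -lee_fin fineK ?fin_num_measure.
Qed.

End digits.

(** * Discrete and continuous distributions *)

Section distribution.
Context {R : realType} (mu : probability R R).

Lemma pure_continuous_not_discrete :
  pure_continuous mu -> ~ pure_discrete mu.
Proof.
move=> mu0 [C cC muC].
have mC : measurable C by exact: countable_measurable.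
have : mu.-negligible (\bigcup_(x in C) [set x]).
  apply: negligible_bigcup_countable => // x _; apply/negligibleP.
    exact: measurable_set1.
  exact: mu0.
rewrite (@bigcup_imset1 _ _ C id) image_id => /(measure_negligible mC) muC0.
have := probability_setC mu mC; rewrite muC muC0 sube0 => /eqP.
by rewrite eq_sym onee_eq0.
Qed.

Lemma point_spectrum_subset (C : set R) :
  countable C -> mu (~` C) = 0%E -> point_spectrum mu `<=` C.
Proof.
move=> cC muC x; rewrite /point_spectrum/= => mux; apply: contrapT => Cx.
move: mux; rewrite lt_neqAle => /andP[/eqP + _]; apply.
apply/esym/eqP; rewrite eq_le measure_ge0 andbT -muC.
apply: le_measure; rewrite ?inE//; last by move=> _ ->.
by apply: measurableC; exact: countable_measurable.
Qed.

End distribution.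

Theorem theorem11 (R : realType) (g0 : R) (hg0 : 2^-1 <= g0 < 1)
    (d : measure_display) (T : measurableType d) (P : probability T R)
    (xi : nat -> {RV P >-> bool}) (p : bool -> nat -> R)
    (p_ge0 : forall e n, 0 <= p e n)
    (p_sum1 : forall n, p false n + p true n = 1)
    (xi_prob : forall (e : bool) (n : nat), P [set w | xi n w = e] = (p e n)%:E)
    (xi_indep : independent_RVs xi) :
  let mu := distribution P (G2_RV hg0 xi) in
  [/\ pure_discrete mu \/ pure_continuous mu,
      pure_discrete mu <-> 0 < max_prob_product p
    & pure_discrete mu ->
      forall c : nat -> bool,
        (forall n, p (c n) n = Num.max (p false n) (p true n)) ->
        point_spectrum mu `<=` G2_tail_set g0 (G2 g0 c)].
Proof.
move=> mu.
have contM0 : max_prob_product p = 0 -> pure_continuous mu.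
  move=> M0 x; rewrite -[LHS]/(P (G2_RV hg0 xi @^-1` [set x])).
  have [[b bx]|nb] := pselect (exists b, G2 g0 b = x); last first.
    rewrite (_ : _ @^-1` _ = set0) ?measure0//.
    apply/seteqP; split=> // w /= xw; apply: nb.
    by exists (fun n => xi n w).
  have mx : measurable (G2_RV hg0 xi @^-1` [set x]).
    by rewrite -[X in measurable X]setTI; exact: measurable_funP.
  apply: (measure_negligible mx).
  have null a : P.-negligible (agree_from xi a 0).
    apply/negligibleP; first exact: measurable_agree_from.
    exact: (probability_sequence_eq0 p_ge0 p_sum1 xi_prob xi_indep).
  (* If the value is [x], the digit sequence is either [b] or one of the
     countably many sequences ending in zeros. *)
  apply: (negligibleS _ (negligibleU (null b) (negligible_bigcup_countable
    (countable_eventually_eq (fun=> false)) (fun a _ => null a)))).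
  move=> w /= wx.
  have [<-|neq] := pselect ((fun n => xi n w) = b); [by left|right].
  exists (fun n => xi n w) => //.
  have [n /eqP bn] : exists n, b n <> xi n w.
    by apply/existsNP => h; apply: neq; apply/funext => n; rewrite h.
  apply/eventually_eqP; exists n.+2 => k nk; rewrite -(subnKC nk).
  apply: (@G2_eq_terminates _ _ hg0 b (fun n => xi n w) n _ bn).
  by rewrite bx -wx.
have conc c : (forall n, p (c n) n = Num.max (p false n) (p true n)) ->
    0 < max_prob_product p ->
    countable (G2 g0 @` eventually_eq c) /\
    mu (~` (G2 g0 @` eventually_eq c)) = 0%E.
  move=> cmax M_gt0.
  have cC : countable (G2 g0 @` eventually_eq c).
    exact: (sub_countable (card_image_le _ _) (countable_eventually_eq c)).
  split => //.
  have mC : measurable (G2 g0 @` eventually_eq c) by exact: countable_measurable.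
  suff mu1 : mu (G2 g0 @` eventually_eq c) = 1%E.
    by apply: (etrans (probability_setC _ mC)); rewrite [X in (_ - X)%E]mu1 subee.
  apply/eqP; rewrite eq_le probability_le1//=.
  rewrite -[leRHS]/(P (G2_RV hg0 xi @^-1` (G2 g0 @` eventually_eq c))).
  rewrite -(probability_agree_eventually p_ge0 p_sum1 xi_prob xi_indep cmax M_gt0).
  apply: le_measure; rewrite ?inE.
  - by apply: bigcupT_measurable => N; exact: measurable_agree_from.
  - by rewrite -[X in measurable X]setTI; exact: measurable_funP.
  - move=> w [N _ wN] /=; exists (fun n => xi n w) => //.
    by apply/eventually_eqP; exists N.
have discM : pure_discrete mu -> 0 < max_prob_product p.
  move=> dmu; rewrite lt_neqAle max_prob_product_ge0// andbT eq_sym.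
  by apply/eqP => /contM0 /pure_continuous_not_discrete.
have Mdisc : 0 < max_prob_product p -> pure_discrete mu.
  have [c cmax] : exists c, forall n, p (c n) n = Num.max (p false n) (p true n).
    exists (fun n => p false n <= p true n) => n.
    by case: leP.
  by move=> /(conc c cmax)[cC muC]; exists (G2 g0 @` eventually_eq c).
split=> //.
- have [M_gt0|] := ltP 0 (max_prob_product p); first by left; exact: Mdisc.
  move=> M_le0; right; apply: contM0; apply/eqP.
  by rewrite eq_le M_le0 max_prob_product_ge0.
- move=> /discM M_gt0 c cmax x; have [cC muC] := conc c cmax M_gt0.
  move=> /(point_spectrum_subset cC muC)[b /eventually_eqP[N bN] bx].
  (* Indices of a common tail have to be positive. *)
  exists c, b; split=> //; exists N.+1, N.+1; split=> // j.
  by rewrite bN// (leq_trans (leqnSn N))// leq_addr.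
Qed.
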